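(* Let $\kappa$ be an infinite cardinal with $\kappa<2^\omega$. If $C\subseteq\mathbb{C}^\infty$ has cardinality $\kappa$ and $S\subseteq\mathbb{C}$ satisfies $S\leq_{BSS}C$ (for BSS computation over $\mathbb{C}$), then either $S$ or its complement $\mathbb{C}-S$ has cardinality $\leq\kappa$. The same holds if instead $C$ has co-cardinality $\kappa$ in $\mathbb{C}^\infty$.
   Context: BSS machines over $\mathbb{C}$: $\mathbb{C}^\infty$ is the set of finite tuples of complex numbers. A BSS machine over $\mathbb{C}$ has a program with finitely many complex constants (parameters); it can apply $+,-,\times,\div$ to cell contents, copy cells, overwrite a cell with $0$, and branch on whether a cell's content equals $0$ (no order comparisons). An oracle machine with oracle $B\subseteq\mathbb{C}^\infty$ may additionally branch on whether a previously computed tuple lies in $B$. $S\leq_{BSS}C$ means the characteristic function of $S$ is computed by such an oracle machine with oracle $C$. *)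

(* Defs.v *)
From Stdlib Require Import Relation_Operators.
From mathcomp Require Import all_boot all_order all_algebra.
From mathcomp Require Import boolp classical_sets functions cardinality reals.
From mathcomp Require Import complex.

Set Implicit Arguments.
Unset Strict Implicit.
Unset Printing Implicit Defensive.

Import GRing.Theory.
Local Open Scope ring_scope.
Local Open Scope classical_set_scope.

(* BSS machines over a field F, branching on equality only.  F^oo is [seq F].
   The memory is a two-way infinite tape of cells, each of which is blank
   ([None]) or contains an element of F.  Programs address cells by their
   position relative to the head, so the head is always at position 0 and
   moving it shifts the tape: this is how a fixed finite program reaches
   unboundedly many cells, hence handles tuples of every length. *)
Section BSS.
Variable F : fieldType.

Definition bss_tape := int -> option F.

Inductive bss_op := BssAdd | BssSub | BssMul | BssDiv.

(* The program counters [l], [l'] are the successors when the test succeeds,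
   resp. fails.  The constants of F occurring in a program (the parameters of
   the machine) are those of its finitely many [BssConst] instructions. *)
Inductive bss_instr :=
| BssConst (d : int) (c : F)
| BssOp (op : bss_op) (d a b : int)
| BssCopy (d a : int)
| BssZero (d : int)
| BssErase (d : int)
| BssRight
| BssLeft
| BssIfZero (a : int) (l l' : nat)
| BssIfBlank (a : int) (l l' : nat)
| BssIfOracle (l l' : nat).

Definition bss_program := seq bss_instr.

(* Program counter and tape. *)
Definition bss_config := (nat * bss_tape)%type.

Definition bss_eval (op : bss_op) (x y : F) : option F :=
  match op with
  | BssAdd => Some (x + y)
  | BssSub => Some (x - y)
  | BssMul => Some (x * y)
  | BssDiv => if y == 0 then None else Some (x / y)
  end.

Definition bss_write (t : bss_tape) (d : int) (v : option F) : bss_tape :=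
  fun i => if i == d then v else t i.

(* Starting at the head, the cells contain the entries of x, then a blank
   ([onth x (size x) = None]). *)
Definition bss_reads (t : bss_tape) (x : seq F) : Prop :=
  forall i : nat, (i <= size x)%N -> t i%:Z = onth x i.

(* Divisions by 0, and arithmetic or zero tests on blank cells, have no
   successor: the machine is then stuck, which is not halting. *)
Inductive bss_step (B : set (seq F)) (p : bss_program) :
    bss_config -> bss_config -> Prop :=
| step_const n t d c : onth p n = Some (BssConst d c) ->
    bss_step B p (n, t) (n.+1, bss_write t d (Some c))
| step_op n t op d a b x y z : onth p n = Some (BssOp op d a b) ->
    t a = Some x -> t b = Some y -> bss_eval op x y = Some z ->
    bss_step B p (n, t) (n.+1, bss_write t d (Some z))
| step_copy n t d a : onth p n = Some (BssCopy d a) ->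
    bss_step B p (n, t) (n.+1, bss_write t d (t a))
| step_zero n t d : onth p n = Some (BssZero d) ->
    bss_step B p (n, t) (n.+1, bss_write t d (Some 0))
| step_erase n t d : onth p n = Some (BssErase d) ->
    bss_step B p (n, t) (n.+1, bss_write t d None)
| step_right n t : onth p n = Some BssRight ->
    bss_step B p (n, t) (n.+1, fun i => t (i + 1))
| step_left n t : onth p n = Some BssLeft ->
    bss_step B p (n, t) (n.+1, fun i => t (i - 1))
| step_ifzero n t a l l' x : onth p n = Some (BssIfZero a l l') ->
    t a = Some x ->
    bss_step B p (n, t) (if x == 0 then l else l', t)
| step_ifblank n t a l l' : onth p n = Some (BssIfBlank a l l') ->
    bss_step B p (n, t) (if t a is None then l else l', t)
| step_iforacle n t l l' x : onth p n = Some (BssIfOracle l l') ->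
    bss_reads t x ->
    bss_step B p (n, t) (if x \in B then l else l', t).

Definition bss_input (x : seq F) : bss_tape :=
  fun i => match i with Posz n => onth x n | Negz _ => None end.

(* The machine p with oracle B halts on input x with output y; it halts when
   the program counter points outside the program. *)
Definition bss_outputs (B : set (seq F)) (p : bss_program) (x y : seq F) :=
  exists (n : nat) (t : bss_tape),
    [/\ clos_refl_trans_1n _ (bss_step B p) (0%N, bss_input x) (n, t),
        (size p <= n)%N & bss_reads t y].

(* S <=_BSS B, for S a set of elements of F (viewed as 1-tuples): some machine
   with oracle B computes the characteristic function of S. *)
Definition bss_reducible (S : set F) (B : set (seq F)) : Prop :=
  exists p : bss_program,
    forall x : F, bss_outputs B p [:: x] [:: (x \in S)%:R].

End BSS.

(* Main.v *)
(* Let [D] be the ring of polynomials generated by the indeterminate, the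
   parameters of the machine, and the entries of the tuples in the oracle (or in
   its complement).  It has at most [kappa] elements, hence so does the set of
   roots of its nonzero members.  Outside this set all inputs [x] behave alike:
   cell contents are values at [x] of fractions over [D], such a value is zero
   only if the fraction is, and a tuple of values lies in the oracle (or in its
   complement) only if its fractions are constants, hence independently of [x].
   So the machine gives the same answer on all these inputs. *)
From Stdlib Require Import Relation_Operators.
Require Import Defs.
From mathcomp Require Import all_boot all_order all_algebra.
From mathcomp Require Import boolp classical_sets functions cardinality reals.
From mathcomp Require Import complex.

Set Implicit Arguments.
Unset Strict Implicit.
Unset Printing Implicit Defensive.

Import GRing.Theory.
Local Open Scope classical_set_scope.
Local Open Scope card_scope.

(** * Comparison of cardinals, up to the square of an infinite set *)

Lemma card_le_rel (T U : Type) (A : set T) (B : set U) (G : T -> U -> Prop) :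
  (forall a, A a -> exists2 b, B b & G a b) ->
  (forall a a' b, A a -> A a' -> G a b -> G a' b -> a = a') -> A #<= B.
Proof.
move=> GAB Ginj.
have GAB' (a : A) : exists b : B, G (set_val a) (set_val b).
  have [b Bb Gab] := GAB _ (set_valP a).
  by exists (SigSub (mem_set Bb)).
have [f Gf] := choice GAB'.
apply/card_leP/injfunPex; exists f => // a a' _ _ ff'; apply: val_inj.
apply: (Ginj _ _ _ (set_valP a) (set_valP a') (Gf a)).
by rewrite ff'; exact: Gf.
Qed.

(** Trades an injection between subtypes for a total function on [T], with dummy value [u0] outside
    [A], so that it can be applied and composed without carrying membership proofs. *)
Lemma card_le_fun (T U : Type) (u0 : U) (A : set T) (B : set U) : A #<= B ->
  exists2 f : T -> U, (forall x, A x -> B (f x)) &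
    (forall x y, A x -> A y -> f x = f y -> x = y).
Proof.
move=> /card_leP[g].
pose f x := if pselect (A x) is left Ax then set_val (g (SigSub (mem_set Ax)))
            else u0.
exists f => [x Ax|x y Ax Ay]; rewrite /f.
  by case: pselect => // Ax'; exact: set_valP.
case: pselect => // Ax'; case: pselect => // Ay' /val_inj.
by move=> /(@inj _ _ _ g _ _ (mem_set I) (mem_set I)) /(congr1 val).
Qed.

(** Zorn's lemma gives a maximal graph [G] of a partial injection from [A] to [B]. If it missed both
    some [a] in [A] and some [b] in [B], the pair [(a, b)] could be added; so it is total on one
    side. *)
Lemma card_le_total (T U : Type) (A : set T) (B : set U) :
  A #<= B \/ B #<= A.
Proof.
pose P (G : set (T * U)) := [/\ G `<=` A `*` B,
  forall a b b', G (a, b) -> G (a, b') -> b = b' &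
  forall a a' b, G (a, b) -> G (a', b) -> a = a'].
have [F FP Ftot|G [[GAB Gfun Ginj] Gmax]] := @Zorn_bigcup _ P.
  have Fdir p q : (\bigcup_(X in F) X) p -> (\bigcup_(X in F) X) q ->
      exists2 X, F X & X p /\ X q.
    move=> [X FX Xp] [Y FY Yq]; have [XY|YX] := Ftot _ _ FX FY.
      by exists Y => //; split => //; exact: XY.
    by exists X => //; split => //; exact: YX.
  split=> [p [X FX Xp]|a b b' /Fdir h /h|a a' b /Fdir h /h].
  - by have [XAB _ _] := FP _ FX; exact: XAB.
  - by move=> [X FX [Xp Xq]]; have [_ Xfun _] := FP _ FX; exact: Xfun Xp Xq.
  - by move=> [X FX [Xp Xq]]; have [_ _ Xinj] := FP _ FX; exact: Xinj Xp Xq.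
have [Atot|/existsNP[a /not_implyP[Aa /forall2NP Ga]]] :=
    pselect (forall a, A a -> exists2 b, B b & G (a, b)).
  by left; apply: (card_le_rel Atot) => a a' b _ _; exact: Ginj.
have {}Ga b : ~ G (a, b).
  by move=> Gab; have [] := Ga b; apply => //; exact: (GAB _ Gab).2.
have [Btot|/existsNP[b /not_implyP[Bb /forall2NP Gb]]] :=
    pselect (forall b, B b -> exists2 a, A a & G (a, b)).
  by right; apply: (card_le_rel Btot) => b b' a' _ _; exact: Gfun.
have {}Gb a' : ~ G (a', b).
  by move=> Gab; have [] := Gb a'; apply => //; exact: (GAB _ Gab).1.
exfalso; apply: (Gmax ((a, b) |` G)).
  split; first by move=> p Gp; right.
  by move=> /(_ (a, b)) h; apply: (Ga b); apply: h; left.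
split=> [p [->//|/GAB//]|a1 b1 b2|a1 a2 b1].
- move=> [[-> ->] [[->]//|/Ga//]|Gab1 [[e _]|]]; last exact: Gfun.
  by case: (Ga b1); rewrite -e.
- move=> [[-> ->] [[->]//|/Gb//]|Gab1 [[_ e]|]]; last exact: Ginj.
  by case: (Gb a1); rewrite -e.
Qed.

Lemma card_le_setX (T T' U U' : Type) (A : set T) (A' : set T') (B : set U)
    (B' : set U') :
  A #<= B -> A' #<= B' -> A `*` A' #<= B `*` B'.
Proof.
move=> /card_leP[f] /card_leP[g].
apply: (@card_le_rel _ _ _ _ (fun x y => exists (a : A) (a' : A'),
   [/\ x = (val a, val a') & y = (val (f a), val (g a'))])).
  move=> [a a'] [Aa Aa']; pose b := SigSub (mem_set Aa) : A.
  pose b' := SigSub (mem_set Aa') : A'.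
  by exists (val (f b), val (g b')); [split; exact: set_valP | exists b, b'].
move=> _ _ _ _ _ [a [a' [-> ->]]] [b [b' [-> [/val_inj e /val_inj e']]]].
by rewrite (@inj _ _ _ f _ _ (mem_set I) (mem_set I) e)
  (@inj _ _ _ g _ _ (mem_set I) (mem_set I) e').
Qed.

(* Hessenberg's theorem.  Take a maximal [A `<=` K] carrying an injection
   [A * A -> A].  If [K \ A] contained a copy [B] of [A], mapping the new pairs
   of elements of [A |` B] injectively into [B] would extend the injection;
   hence [K] is the union of two sets no larger than [A]. *)
Lemma card_setXX_infinite (T : Type) (K : set T) :
  infinite_set K -> K `*` K #<= K.
Proof.
move=> Kinf; have [k0 Kk0] := infinite_setN0 Kinf.
have /infiniteP/(card_le_fun k0)[i0 i0K i0inj] := Kinf.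
pose pairing (A : set T) (f : T -> T -> T) :=
  (forall u v, A u -> A v -> A (f u v)) /\
  (forall u v u' v', A u -> A v -> A u' -> A v' -> f u v = f u' v' ->
     u = u' /\ v = v').
pose A0 := range i0.
(* On the countable set [A0], transport the injection [pickle] of pairs of naturals along [i0]; [j]
   inverts [i0] on [A0]. *)
have [f0 f0A] : exists f0, pairing A0 f0.
  have i0K' n : exists m, i0 m = i0 n by exists n.
  have inv u : exists n, A0 u -> i0 n = u.
    have [[n _ <-]|nA] := pselect (A0 u); first by exists n.
    by exists 0%N => /nA.
  have [j jK] := choice inv.
  exists (fun u v => i0 (pickle (j u, j v))); split=> [u v _ _|].
    by eexists.
  move=> u v u' v' /jK ju /jK jv /jK ju' /jK jv' /i0inj.
  move=> /(_ I I)/(pcan_inj pickleK)[e e'].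
  by rewrite -ju -jv -ju' -jv' e e'.
(* Requiring [A0] inside every candidate provides two distinct elements [i0 0] and [i0 1] of it,
   used as tags below. *)
pose valid (p : set T * (T -> T -> T)) :=
  [/\ A0 `<=` p.1, p.1 `<=` K & pairing p.1 p.2].
pose X := {p | valid p}.
(* Extension of pairings. Functions are compared on the smaller domain only, so this is a preorder
   and not an order. *)
pose R (p q : X) := `[< (sval p).1 `<=` (sval q).1 /\
   forall u v, (sval p).1 u -> (sval p).1 v ->
     (sval p).2 u v = (sval q).2 u v >].
have A0K : A0 `<=` K by move=> _ [n _ <-]; exact: i0K.
have Rtrans (r s t : X) : R r s -> R s t -> R r t.
  move=> /asboolP[rs1 rs2] /asboolP[st1 st2]; apply/asboolP; split.
    exact: subset_trans st1.
  by move=> u v ru rv; rewrite rs2// st2//; exact: rs1.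
have x0 : X by exists (A0, f0); split.
have [|||[[A f] Af] Amax] := @ZL_preorder X x0 R.
- by move=> p; apply/asboolP; split.
- exact: Rtrans.
- move=> F Ftot; have [[p Fp]|F0] := pselect (exists p, F p); last first.
    by exists x0 => s Fs; case: F0; exists s.
  pose A := \bigcup_(p in F) (sval p).1.
  (* Pairing on the union of the chain: all members whose domain contains both components agree on
     the pair; elsewhere the value [k0] is arbitrary. *)
  have gex (u : T * T) : exists w, forall q, F q -> (sval q).1 u.1 ->
      (sval q).1 u.2 -> w = (sval q).2 u.1 u.2.
    have [[q [Fq qu qv]]|nq] := pselect (exists q : X,
        [/\ F q, (sval q).1 u.1 & (sval q).1 u.2]); last first.
      by exists k0 => q Fq qu qv; case: nq; exists q.
    exists ((sval q).2 u.1 u.2) => q' Fq' q'u q'v.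
    by have [/asboolP[_ ->]|/asboolP[_ ->]] := Ftot _ _ Fq Fq'.
  have [g gE] := choice gex; pose f u v := g (u, v).
  have fE q u v : F q -> (sval q).1 u -> (sval q).1 v ->
      f u v = (sval q).2 u v by exact: (gE (u, v)).
  have Fdir (q1 q2 : X) : F q1 -> F q2 -> exists2 q, F q &
      (sval q1).1 `<=` (sval q).1 /\ (sval q2).1 `<=` (sval q).1.
    move=> Fq1 Fq2; have [/asboolP[h _]|/asboolP[h _]] := Ftot _ _ Fq1 Fq2.
      by exists q2 => //; split.
    by exists q1 => //; split.
  have Adir u v : A u -> A v -> exists2 q, F q & (sval q).1 u /\ (sval q).1 v.
    move=> [q1 Fq1 q1u] [q2 Fq2 q2v]; have [q Fq [s1 s2]] := Fdir _ _ Fq1 Fq2.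
    by exists q => //; split; [exact: s1|exact: s2].
  have Aok : valid (A, f).
    split=> /=.
    - by move=> u A0u; exists p => //; have [/(_ _ A0u)] := svalP p.
    - by move=> u [q _ qu]; have [_ /(_ _ qu)] := svalP q.
    split=> [u v Au Av|u v u' v' Au Av Au' Av'].
      have [q Fq [qu qv]] := Adir _ _ Au Av.
      rewrite (fE q)//; exists q => //.
      by have [_ _ [h _]] := svalP q; exact: h.
    have [q1 Fq1 [q1u q1v]] := Adir _ _ Au Av.
    have [q2 Fq2 [q2u q2v]] := Adir _ _ Au' Av'.
    have [q Fq [s1 s2]] := Fdir _ _ Fq1 Fq2.
    rewrite !(fE q)//; try by [exact: s1|exact: s2].
    by have [_ _ [_ h]] := svalP q; apply: h; try by [exact: s1|exact: s2].
  exists (exist _ _ Aok) => s Fs; apply/asboolP; split=> /=.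
    by move=> u su; exists s.
  by move=> u v su sv; rewrite (fE s).
have [/= A0A AK [fA finj]] := Af.
have Ai n : A (i0 n) by apply: A0A; exists n.
have i01 : i0 0%N <> i0 1%N by move=> /i0inj => /(_ I I).
have AA : A `*` A #<= A.
  apply: (@card_le_rel _ _ _ _ (fun p w => w = f p.1 p.2)).
    by move=> p [p1 p2]; eexists; last reflexivity; exact: fA.
  move=> [u v] [u' v'] _ [/= Au Av] [/= Au' Av'] -> e.
  by have [-> ->] := finj _ _ _ _ Au Av Au' Av' e.
(* Pair an element of [A] with the tag [i0 0], and the image in [A] of any other element with the
   tag [i0 1]. *)
have AU (D : set T) : D #<= A -> A `|` D #<= A.
  move=> /(card_le_fun k0)[g gA ginj].
  apply: (@card_le_rel _ _ _ _ (fun u w => A u /\ w = f (i0 0%N) u \/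
                                           ~ A u /\ w = f (i0 1%N) (g u))).
    move=> u ADu; have [Au|nAu] := pselect (A u).
      by exists (f (i0 0%N) u); [exact: fA|left].
    exists (f (i0 1%N) (g u)); last by right.
    by case: ADu => // Du; apply: fA => //; exact: gA.
  have Ag u : (A `|` D) u -> ~ A u -> A (g u) by case=> // Du _; exact: gA.
  move=> u v w ADu ADv [[Au ->]|[nAu ->]] [[Av e]|[nAv e]].
  - by have [] := finj _ _ _ _ (Ai 0%N) Au (Ai 0%N) Av e.
  - by have [] := finj _ _ _ _ (Ai 0%N) Au (Ai 1%N) (Ag _ ADv nAv) e.
  - by have [/esym] := finj _ _ _ _ (Ai 1%N) (Ag _ ADu nAu) (Ai 0%N) Av e.
  - have [_] := finj _ _ _ _ (Ai 1%N) (Ag _ ADu nAu) (Ai 1%N) (Ag _ ADv nAv) e.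
    by case: ADu => // Du; case: ADv => // Dv; exact: ginj.
have [KA|] := card_le_total (K `\` A) A.
  have {}KA : K #<= A.
    apply: card_le_trans (AU _ KA); apply: subset_card_le => u Ku.
    by have [Au|nAu] := pselect (A u); [left|right].
  apply: (card_le_trans (card_le_setX KA KA)); apply: (card_le_trans AA).
  exact: subset_card_le.
move=> /(card_le_fun k0)[b bA binj].
pose B := b @` A; pose A' := A `|` B.
have BnA u : B u -> ~ A u by move=> [v Av <-]; have [] := bA _ Av.
have [c cA cinj] := card_le_fun k0 (AU B (card_image_le _ _)).
(* A new pair is sent into [A * A] by [c], coded in [A] by [f], then moved by [b] into [B]. As [B]
   is disjoint from [A], it cannot collide with an old pair. *)
pose f' u v := if pselect (A u /\ A v) is left _ then f u v
               else b (f (c u) (c v)).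
have Afc u v : A' u -> A' v -> A (f (c u) (c v)).
  by move=> /cA cu /cA cv; exact: fA.
have A'ok : valid (A', f').
  split=> /=.
  - by apply: subset_trans A0A _; exact: subsetUl.
  - by move=> u [/AK//|[v Av <-]]; have [] := bA _ Av.
  split=> [u v A'u A'v|u v u' v' A'u A'v A'u' A'v']; rewrite /f'.
    case: pselect => [[Au Av]|_]; first by left; exact: fA.
    by right; exists (f (c u) (c v)) => //; exact: Afc.
  case: pselect => [[Au Av]|nA]; case: pselect => [[Au' Av']|nA'].
  - exact: finj.
  - move=> e; exfalso; apply: (BnA (f u v)); last exact: fA.
    by rewrite e; exists (f (c u') (c v')) => //; exact: Afc.
  - move=> e; exfalso; apply: (BnA (f u' v')); last exact: fA.
    by rewrite -e; exists (f (c u) (c v)) => //; exact: Afc.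
  - move=> /(binj _ _ (Afc _ _ A'u A'v) (Afc _ _ A'u' A'v')) e.
    have [] := finj _ _ _ _ (cA _ A'u) (cA _ A'v) (cA _ A'u') (cA _ A'v') e.
    by move=> /cinj-> // /cinj->.
have /asboolP[/= A'A _] : R (exist _ _ A'ok) (exist _ _ Af : X).
  apply: Amax; apply/asboolP; split=> /= [u Au|u v Au Av]; first by left.
  by rewrite /f'; case: pselect => // -[].
have Bb : B (b (i0 0%N)) by exists (i0 0%N).
by case: (BnA _ Bb); apply: A'A; right.
Qed.

(** * Products, lists and generated semirings bounded by an infinite cardinal *)

Section InfiniteBound.
Variables (U : Type) (K : set U).
Hypothesis Kinf : infinite_set K.

Lemma card_setX_le (T T' : Type) (A : set T) (A' : set T') :
  A #<= K -> A' #<= K -> A `*` A' #<= K.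
Proof.
move=> AK A'K; apply: card_le_trans (card_setXX_infinite Kinf).
exact: card_le_setX.
Qed.

(** Folding an injection of [K * K] into [K] codes a list by one element of [K]. Injectivity is
    proved only between lists of equal length, hence the length is recorded next to the code. *)
Lemma card_seq_le (T : eqType) (A : set T) : A #<= K ->
  [set s : seq T | forall x, x \in s -> A x] #<= K.
Proof.
move=> AK; have [k0 Kk0] := infinite_setN0 Kinf.
have [f fK finj] := card_le_fun k0 AK.
have [h hK hinj] := card_le_fun k0 (card_setXX_infinite Kinf).
pose code := foldr (fun x c => h (f x, c)) k0.
have codeK s : (forall x, x \in s -> A x) -> K (code s).
  elim: s => [//|x s IH] sA /=; apply: hK; split=> /=.
    by apply: fK; apply: sA; rewrite mem_head.
  by apply: IH => y ys; apply: sA; rewrite in_cons ys orbT.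
have codeinj s s' : (forall x, x \in s -> A x) -> (forall x, x \in s' -> A x) ->
    size s = size s' -> code s = code s' -> s = s'.
  elim: s s' => [|x s IH] [|x' s']//= sA s'A [ss'] e.
  have sA' y : y \in s -> A y by move=> ys; apply: sA; rewrite in_cons ys orbT.
  have s'A' y : y \in s' -> A y.
    by move=> ys; apply: s'A; rewrite in_cons ys orbT.
  have Ax : A x by apply: sA; rewrite mem_head.
  have Ax' : A x' by apply: s'A; rewrite mem_head.
  have Kfx : (K `*` K) (f x, code s) by split; [exact: fK|exact: codeK].
  have Kfx' : (K `*` K) (f x', code s') by split; [exact: fK|exact: codeK].
  have [] := hinj _ _ Kfx Kfx' e.
  by move=> /finj-> // /IH->.
apply: (card_le_trans _ (card_setX_le (_ : [set: nat] #<= K) (card_lexx K))).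
  apply: (@card_le_rel _ _ _ _ (fun s p => p = (size s, code s))).
    by move=> s sA; eexists; last reflexivity; split=> //; exact: codeK.
  by move=> s s' _ sA s'A -> [e1 e2]; exact: codeinj.
exact/infiniteP.
Qed.

(** The finite sums of finite products of generators form such a [D], and each is given by a list of
    lists over [G]. Products are closed by distributivity: concatenate every word of one sum with
    every word of the other. *)
Lemma card_gen_subsemiring (A : comPzSemiRingType) (G : set A) : G #<= K ->
  exists D : set A,
    [/\ G `<=` D, D #<= K, D 0%R, D 1%R &
      (forall p q, D p -> D q -> D (p + q)%R) /\
      (forall p q, D p -> D q -> D (p * q)%R)].
Proof.
move=> GK; pose words := [set w : seq A | forall g, g \in w -> G g].
pose sums := [set s : seq (seq A) | forall w, w \in s -> words w].
exists ((fun s => (\sum_(w <- s) \prod_(g <- w) g)%R) @` sums); split.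
- move=> g Gg; exists [:: [:: g]]; last by rewrite !big_seq1.
  by move=> w; rewrite inE => /eqP-> h; rewrite inE => /eqP->.
- apply: (card_le_trans (card_image_le _ _)).
  by do 2!apply: card_seq_le.
- by exists [::]; rewrite ?big_nil.
- exists [:: [::]]; last by rewrite big_seq1 big_nil.
  by move=> w; rewrite inE => /eqP-> h; rewrite in_nil.
split=> _ _ [s sD <-] [s' s'D <-].
  exists (s ++ s'); last by rewrite big_cat.
  by move=> w; rewrite mem_cat => /orP[/sD|/s'D].
exists [seq w ++ w' | w <- s, w' <- s'].
  move=> _ /allpairsP[[w w'] [/= /sD ws /s'D ws' ->]] g.
  by rewrite mem_cat => /orP[/ws|/ws'].
rewrite big_allpairs_dep mulr_suml; apply: eq_bigr => w _.
by rewrite mulr_sumr; apply: eq_bigr => w' _; rewrite big_cat.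
Qed.

End InfiniteBound.

(** * Determinism of BSS machines, and transfer of runs along a relation between cell contents *)

Section BssSimulation.
Variables (F : fieldType) (B : set (seq F)).
Local Open Scope ring_scope.

(** The blank ending one tuple rules out that the other is longer, so the lengths agree, and then
    the entries. *)
Lemma bss_reads_inj (t : bss_tape F) (x y : seq F) :
  bss_reads t x -> bss_reads t y -> x = y.
Proof.
have size_le (x' y' : seq F) : bss_reads t x' -> bss_reads t y' ->
    (size y' <= size x')%N.
  move=> tx ty; rewrite leqNgt; apply/negP => xy.
  by have := onthTE y' (size x'); rewrite -ty ?(ltnW xy)// tx// onth_default// xy.
move=> tx ty; apply: eq_from_onth_le => i.
rewrite (@anti_leq (size x) (size y)) ?size_le// maxnn => iy.
by rewrite -tx ?(leq_trans (ltnW iy) (size_le _ _ tx ty))// ty// ltnW.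
Qed.

Lemma bss_step_det (p : bss_program F) c c1 c2 :
  bss_step B p c c1 -> bss_step B p c c2 -> c1 = c2.
Proof.
case=> [n t d a e|n t op d a b x y z e ta tb ev|n t d a e|n t d e|n t d e|n t e
  |n t e|n t a l l' x e ta|n t a l l' e|n t l l' x e tx] s; inversion s;
  try congruence.
all: match goal with
     | h : onth ?q ?k = Some _, h' : onth ?q ?k = Some _ |- _ =>
         rewrite h in h'; injection h'; clear h'; intros; subst
     end.
- by have -> : x = x0 by congruence.
- by [].
- by have -> : x = x0 by exact: (@bss_reads_inj t).
Qed.

(** A halted configuration has no successor, so by determinism of steps neither of two halting runs
    can stop before the other. *)
Lemma bss_outputs_det (p : bss_program F) x y y' :
  bss_outputs B p x y -> bss_outputs B p x y' -> y = y'.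
Proof.
have stuck c c' : (size p <= c.1)%N -> ~ bss_step B p c c'.
  by move=> /onth_default pc s; case: s pc => /= *; congruence.
move=> [n [t [r pn ty]]] [n' [t' [r' pn' ty']]].
suff [_ tt'] : (n, t) = (n', t') by apply: (bss_reads_inj ty); rewrite tt'.
move: (pn : (size p <= (n, t).1)%N) (pn' : (size p <= (n', t').1)%N) r r'.
move: (n, t) (n', t') => c c' pc pc' r.
elim: r pc => [{}c|c0 c1 {}c s _ IH] pc r'; first
  by case: r' pc' => // ? ? s; case: (stuck _ _ pc s).
case: r' s pc' IH => [s pc'|c2 c3 s2 r2 s pc' IH].
  by case: (stuck _ _ pc' s).
by apply: IH => //; rewrite (bss_step_det s s2).
Qed.

(** Blanks match only blanks: related tapes then agree on blank tests and on where a tuple ends. *)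
Definition orel (rel : F -> F -> Prop) (a b : option F) : Prop :=
  match a, b with
  | Some x, Some y => rel x y
  | None, None => True
  | _, _ => False
  end.

Definition list_rel (rel : F -> F -> Prop) (s s' : seq F) : Prop :=
  forall i, orel rel (onth s i) (onth s' i).

Lemma bss_reads_rel rel (t t' : bss_tape F) s :
  (forall i, orel rel (t i) (t' i)) -> bss_reads t s ->
  exists2 s', list_rel rel s s' & bss_reads t' s'.
Proof.
(* The default [0] is never taken: the first [size s] cells of [t] are filled, hence so are those of
   [t']. *)
move=> tt' ts; pose s' := mkseq (fun i : nat => odflt 0 (t' i%:Z)) (size s).
have s'E i : (i <= size s)%N -> onth s' i = t' i%:Z.
  move=> /[dup] isz; rewrite leq_eqVlt => /orP[/eqP->|ilt].
    rewrite onth_default ?size_mkseq//.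
    by have := tt' (size s)%:Z; rewrite ts// onth_default//; case: (t' _).
  rewrite /s' onth_map /= onthE (nth_map 0%N) ?size_iota// nth_iota//= add0n.
  have := tt' i%:Z; rewrite ts//; have := onthTE s i; rewrite ilt.
  by case: (onth s i) => // a _; case: (t' _).
exists s' => i; last by rewrite size_mkseq => /s'E.
have [ile|ilt] := leqP i (size s); first by rewrite s'E// -ts.
by rewrite !onth_default ?size_mkseq// ltnW.
Qed.

Section Relation.
Variables (p : bss_program F) (rel : F -> F -> Prop).
Hypothesis rel_const : forall n d c, onth p n = Some (BssConst d c) -> rel c c.
Hypothesis rel0 : rel 0 0.
Hypothesis rel_eval : forall op a b c a' b', rel a a' -> rel b b' ->
  bss_eval op a b = Some c ->
  exists2 c', bss_eval op a' b' = Some c' & rel c c'.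
Hypothesis rel_eq0 : forall a b, rel a b -> (a == 0) = (b == 0).
Hypothesis rel_oracle :
  forall s s', list_rel rel s s' -> (s \in B) = (s' \in B).

(** The hypotheses on [rel] cover constants, zeroing, arithmetic, zero tests and oracle queries. All
    tests have the same outcome on both tapes, so one program counter serves both runs. *)
Lemma bss_step_rel c c' (t' : bss_tape F) :
  bss_step B p c c' -> (forall i, orel rel (c.2 i) (t' i)) ->
  exists2 u', forall i, orel rel (c'.2 i) (u' i) &
    bss_step B p (c.1, t') (c'.1, u').
Proof.
have wr (t : bss_tape F) d v v' : (forall i, orel rel (t i) (t' i)) ->
    orel rel v v' ->
    forall i, orel rel (bss_write t d v i) (bss_write t' d v' i).
  by move=> tt' vv' i; rewrite /bss_write; case: eqP.
have some (t : bss_tape F) a x : (forall i, orel rel (t i) (t' i)) ->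
    t a = Some x -> exists2 x', t' a = Some x' & rel x x'.
  move=> tt' e; have := tt' a; rewrite e /=.
  by case: (t' a) => // x' ?; exists x'.
case=> {c c'} [n t d a e|n t op d a b x y z e ta tb ev|n t d a e|n t d e|n t d e
  |n t e|n t e|n t a l l' x e ta|n t a l l' e|n t l l' x e tx] /= tt'.
- exists (bss_write t' d (Some a)); last exact: step_const.
  by apply: wr => //; exact: rel_const e.
- have [x' tx' rx] := some _ _ _ tt' ta; have [y' ty' ry] := some _ _ _ tt' tb.
  have [z' ez' rz] := rel_eval rx ry ev.
  exists (bss_write t' d (Some z')); first exact: wr.
  exact: step_op e tx' ty' ez'.
- by exists (bss_write t' d (t' a)); [exact: wr|exact: step_copy].
- by exists (bss_write t' d (Some 0)); [exact: wr|exact: step_zero].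
- by exists (bss_write t' d None); [exact: wr|exact: step_erase].
- by exists (fun i => t' (i + 1)) => //; exact: step_right.
- by exists (fun i => t' (i - 1)) => //; exact: step_left.
- have [x' tx' rx] := some _ _ _ tt' ta; exists t' => //.
  by rewrite (rel_eq0 rx); exact: step_ifzero e tx'.
- exists t' => //; have -> : (if t a is None then l else l') =
    if t' a is None then l else l'; last exact: step_ifblank.
  by have := tt' a; case: (t a) (t' a) => [?|] [?|].
- have [x' xx' tx'] := bss_reads_rel tt' tx; exists t' => //.
  by rewrite (rel_oracle xx'); exact: step_iforacle.
Qed.

Lemma bss_run_rel c c' (t' : bss_tape F) :
  clos_refl_trans_1n _ (bss_step B p) c c' ->
  (forall i, orel rel (c.2 i) (t' i)) ->
  exists2 u', forall i, orel rel (c'.2 i) (u' i) &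
    clos_refl_trans_1n _ (bss_step B p) (c.1, t') (c'.1, u').
Proof.
move=> r; elim: r t' => [{}c t' tt'|c0 c1 {}c s _ IH t' tt'].
  by exists t' => //; constructor.
have [t1 tt1 s1] := bss_step_rel s tt'; have [u' tu' r'] := IH _ tt1.
by exists u' => //; apply: rt1n_trans s1 r'.
Qed.

Lemma bss_outputs_rel x x' y : list_rel rel x x' -> bss_outputs B p x y ->
  exists2 y', list_rel rel y y' & bss_outputs B p x' y'.
Proof.
move=> xx' [n [t [r pn ty]]].
have ii' i : orel rel (bss_input x i) (bss_input x' i).
  by case: i => // i; exact: xx'.
have [t' tt' r'] := bss_run_rel r ii'.
by have [y' yy' ty'] := bss_reads_rel tt' ty; exists y' => //; exists n, t'.
Qed.

End Relation.
End BssSimulation.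

(** * Transcendental points, and the fractions evaluated at them *)

Section Transcendental.
Variables (F : fieldType) (D : set {poly F}).
Local Open Scope ring_scope.

(** For [D] the polynomials over a subring [A], this is transcendence over [A] in the usual
    sense. *)
Definition transcendental_over (x : F) : Prop :=
  forall p, D p -> root p x -> p = 0.

(** For [D] the polynomials over a subring with fraction field [k], and [x], [y] transcendental,
    this is the graph of the isomorphism from [k(x)] to [k(y)] over [k] that sends [x] to [y]. *)
Definition same_fraction (x y a b : F) : Prop :=
  exists p q, [/\ D p, D q, q != 0, a = p.[x] / q.[x] & b = p.[y] / q.[y]].

Hypotheses (D0 : D 0) (D1 : D 1) (DN1 : D (- 1)).
Hypothesis DD : forall p q, D p -> D q -> D (p + q).
Hypothesis DM : forall p q, D p -> D q -> D (p * q).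

Lemma transcendental_horner_neq0 x q :
  transcendental_over x -> D q -> q != 0 -> q.[x] != 0.
Proof. by move=> xtr Dq; apply: contra => /(xtr q Dq)->. Qed.

Lemma same_fraction_sym x y a b :
  same_fraction x y a b -> same_fraction y x b a.
Proof. by move=> [p [q [Dp Dq q0 -> ->]]]; exists p, q. Qed.

Lemma same_fraction_const x y c : D c%:P -> same_fraction x y c c.
Proof.
by move=> Dc; exists c%:P, 1; rewrite oner_neq0 !hornerE !divr1; split.
Qed.

Lemma same_fraction_id x y : D 'X -> same_fraction x y x y.
Proof.
by move=> DX; exists 'X, 1; rewrite oner_neq0 !hornerE !divr1; split.
Qed.

Variables x y : F.
Hypotheses (xtr : transcendental_over x) (ytr : transcendental_over y).

Lemma same_fraction_eval op a b c a' b' :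
  same_fraction x y a a' -> same_fraction x y b b' -> bss_eval op a b = Some c ->
  exists2 c', bss_eval op a' b' = Some c' & same_fraction x y c c'.
Proof.
move=> [p [q [Dp Dq q0 -> ->]]] [r [s [Dr Ds s0 -> ->]]].
have [qx qy] := (transcendental_horner_neq0 xtr Dq q0,
                 transcendental_horner_neq0 ytr Dq q0).
have [sx sy] := (transcendental_horner_neq0 xtr Ds s0,
                 transcendental_horner_neq0 ytr Ds s0).
have qs0 : q * s != 0 by rewrite mulf_neq0.
have Dqs := DM Dq Ds.
case: op => /=.
- move=> -[<-]; eexists; first reflexivity.
  exists (p * s + r * q), (q * s); rewrite !hornerE !addf_div//; split => //.
  by apply: DD; exact: DM.
- move=> -[<-]; eexists; first reflexivity.
  (* [D] is assumed closed under sums and products only, so subtraction is a product with [- 1]. *)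
  exists (p * s + - 1 * r * q), (q * s).
  split => //; first by apply: DD; [exact: DM|apply: DM => //; exact: DM].
    by rewrite !hornerE -mulNr addf_div// mulN1r.
  by rewrite !hornerE -mulNr addf_div// mulN1r.
- move=> -[<-]; eexists; first reflexivity.
  by exists (p * r), (q * s); rewrite !hornerM !mulf_div; split => //; exact: DM.
(* The divisor is nonzero at [x], so its numerator [r] is a nonzero polynomial, which cannot vanish
   at [y] either: the division succeeds there too. *)
case: eqP => // /eqP rs0 [<-].
have r0 : r != 0 by apply: contra_neq rs0 => ->; rewrite horner0 mul0r.
have ry := transcendental_horner_neq0 ytr Dr r0.
rewrite mulf_eq0 invr_eq0 (negbTE ry) (negbTE sy) /=.
eexists; first reflexivity.
exists (p * s), (q * r); rewrite !hornerM !invf_div !mulf_div mulf_neq0//.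
by split => //; exact: DM.
Qed.

(** If [p / q] takes the value [c] at [x], then [p - c q] is a member of [D] vanishing at [x], so
    [p = c q] and the fraction is constant. The case [c = 0] will settle zero tests. *)
Lemma same_fraction_fixed c b : D c%:P -> same_fraction x y c b -> b = c.
Proof.
move=> Dc [p [q [Dp Dq q0 cE ->]]].
have [qx qy] := (transcendental_horner_neq0 xtr Dq q0,
                 transcendental_horner_neq0 ytr Dq q0).
have /eqP : p + - 1 * (c%:P * q) = 0.
  apply: xtr; first by apply: DD => //; do 2!apply: DM => //.
  by rewrite mulN1r rootE !hornerE cE divfK// subrr.
rewrite mulN1r subr_eq0 => /eqP ->.
by rewrite !hornerE mulfK.
Qed.

End Transcendental.

(** The entries of a tuple in [C] are constants of [D], hence are related only to themselves, and
    the related tuple is the same one. The converse exchanges [x] and [y]. *)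
Lemma same_fraction_oracle (F : fieldType) (D : set {poly F}) (C : set (seq F))
    (x y : F) :
  D 0%R -> D 1%R -> D (- 1)%R ->
  (forall p q, D p -> D q -> D (p + q)%R) ->
  (forall p q, D p -> D q -> D (p * q)%R) ->
  (forall s c, C s -> c \in s -> D c%:P%R) ->
  transcendental_over D x -> transcendental_over D y ->
  forall s s', list_rel (same_fraction D x y) s s' -> C s <-> C s'.
Proof.
move=> D0 D1 DN1 DD DM DC xtr ytr s s'.
wlog suff WL : x y xtr ytr s s' /
    list_rel (same_fraction D x y) s s' -> C s -> C s'.
  move=> ss'; split; first by apply: (WL x y).
  apply: (WL y x) => // i; have := ss' i.
  by case: (onth s i) (onth s' i) => [a|] [b|] //=; exact: same_fraction_sym.
move=> ss' Cs; rewrite (_ : s' = s)//; apply: eq_from_onth => i.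
have := ss' i; case es: (onth s i) => [a|]; case: (onth s' i) => [b|] //= ab.
congr Some; apply: same_fraction_fixed ab => //.
by apply: DC Cs _; apply/onthP; exists i.
Qed.

(** An excluded point is determined by a nonzero polynomial of [D] vanishing at it and its position
    in the list of roots of that polynomial, that is, by an element of [D * nat]. *)
Lemma card_algebraic_le (F : closedFieldType) (U : Type) (K : set U)
    (D : set {poly F}) :
  infinite_set K -> D #<= K -> ~` [set x | transcendental_over D x] #<= K.
Proof.
move=> Kinf DK.
have rootsP (p : {poly F}) :
    exists r : seq F, p != 0%R -> forall x, root p x -> x \in r.
  have [r pE] := closed_field_poly_normal p; exists r => p0 x.
  by rewrite pE rootZ ?lead_coef_eq0// root_prod_XsubC.
have [roots rootsE] := choice rootsP.
have DNK : D `*` [set: nat] #<= K.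
  by apply: card_setX_le => //; exact/infiniteP.
apply: (card_le_trans _ DNK).
apply: (card_le_trans _ (card_image_le (fun pn => nth 0%R (roots pn.1) pn.2) _)).
apply: subset_card_le => x /existsNP[p /not_implyP[Dp /not_implyP[px p0]]].
have xr : x \in roots p by apply: rootsE => //; exact/eqP.
by exists (p, index x (roots p)); rewrite //= nth_index.
Qed.

(** * From a reduction to the cardinality bound *)

Definition bss_constants (F : fieldType) (p : bss_program F) : seq F :=
  pmap (fun i => if i is BssConst _ c then Some c else None) p.

Lemma mem_bss_constants (F : fieldType) (p : bss_program F) n d c :
  onth p n = Some (BssConst d c) -> c \in bss_constants p.
Proof.
elim: p n => [|i p IH] [|n] //=; first by move=> [->]; rewrite /= mem_head.
by move=> /IH; rewrite /bss_constants /=; case: i => //= *; rewrite in_cons orbC;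
  apply/orP; left.
Qed.

Lemma bss_reducible_card_le (F : closedFieldType) (U : Type) (K : set U)
    (C C0 : set (seq F)) (S : set F) :
  infinite_set K -> C0 #= K -> C = C0 \/ C = ~` C0 -> bss_reducible S C ->
  S #<= K \/ ~` S #<= K.
Proof.
move=> Kinf; rewrite card_eq_le => /andP[C0K KC0] CC0 [p pS].
have [s0 C0s0] : C0 !=set0.
  by apply: infinite_setN0 => fC0; apply: Kinf; exact: card_le_finite fC0.
have NK : [set: nat] #<= K by exact/infiniteP.
have [gens [gX gN1 gc]] : exists gens : seq {poly F},
    [/\ 'X%R \in gens, (- 1)%R \in gens &
      {in bss_constants p, forall c, c%:P%R \in gens}].
  exists ('X%R :: (- 1)%R :: map polyC (bss_constants p)).
  by split=> [||c cp]; rewrite !inE ?eqxx ?orbT// map_f ?orbT.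
(* A generator is named by a tuple of [C0] and an index into [gens] followed by the entries of the
   tuple; an index out of range gives [0]. The tuple [s0] will serve to name the members of
   [gens]. *)
have gensK : (fun ns => nth 0%R (gens ++ map polyC ns.2) ns.1) @`
    ([set: nat] `*` C0) #<= K.
  apply: (card_le_trans (card_image_le _ _)); exact: card_setX_le.
have [D [GD DK D0 D1 [DD DM]]] := card_gen_subsemiring Kinf gensK.
have Dgens g : g \in gens -> D g.
  move=> gg; apply: GD; exists (index g gens, s0) => //.
  by rewrite /= nth_cat index_mem gg nth_index.
have DC0 s c : C0 s -> c \in s -> D c%:P%R.
  move=> C0s cs; apply: GD; exists ((size gens + index c s)%N, s) => //.
  rewrite /= nth_cat -ltn_subRL subnn ltn0 addKn (nth_map 0%R) ?index_mem//.
  by rewrite nth_index.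
have [DX DN1] := (Dgens _ gX, Dgens _ gN1).
have same x y : transcendental_over D x -> transcendental_over D y -> S x -> S y.
  move=> xtr ytr Sx.
  have ro := same_fraction_oracle D0 D1 DN1 DD DM DC0 xtr ytr.
  (* Only the entries of tuples in [C0] were put into [D]; when [C] is the complement of [C0], the
     answers are merely negated. *)
  have oracle s s' : list_rel (same_fraction D x y) s s' ->
      (s \in C) = (s' \in C).
    move=> /ro h; have C0E : (s \in C0) = (s' \in C0).
      by apply/idP/idP; rewrite !in_setE h.
    by case: CC0 => ->; rewrite ?in_setC C0E.
  have xy : list_rel (same_fraction D x y) [:: x] [:: y].
    by case=> [|i]; [exact: same_fraction_id|rewrite !onth_default].
  have r0 : same_fraction D x y 0%R 0%R by exact: same_fraction_const.
  have rc n d c : onth p n = Some (BssConst d c) -> same_fraction D x y c c.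
    move=> /mem_bss_constants cp; apply: same_fraction_const => //.
    exact: Dgens (gc _ cp).
  have r_eq0 a b : same_fraction D x y a b -> (a == 0)%R = (b == 0)%R.
    move=> ab; apply/eqP/eqP => e; rewrite e in ab.
      exact: same_fraction_fixed ab.
    by apply: same_fraction_fixed (same_fraction_sym ab).
  have [y' yy' py'] := bss_outputs_rel rc r0
    (same_fraction_eval DN1 DD DM xtr ytr) r_eq0 oracle xy (pS x).
  (* The output on [y] is related to the output [1] on [x], so it is nonzero, which forces [y] into
     [S]. *)
  have := yy' 0%N; rewrite -(bss_outputs_det (pS y) py') /= => /r_eq0.
  rewrite (mem_set Sx) oner_eq0; case: (boolP (y \in S)); last by rewrite eqxx.
  by move=> /set_mem.
have AK := card_algebraic_le Kinf DK.
(* If one transcendental point lies in [S], all do and the complement of [S] consists of algebraic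
   points; otherwise [S] does. *)
have [[x [xtr Sx]]|noS] := pselect (exists x, transcendental_over D x /\ S x).
  right; apply: card_le_trans AK; apply: subset_card_le => y nSy ytr.
  exact: nSy (same _ _ xtr ytr Sx).
left; apply: card_le_trans AK; apply: subset_card_le => y Sy ytr.
by case: noS; exists y.
Qed.

(* The cardinal kappa is given by a set K of that cardinality. *)
Theorem theorem8p1 (R : realType) (T : Type) (K : set T)
    (C : set (seq R[i])) (S : set R[i]) :
  infinite_set K ->
  (K #<= [set: nat -> bool] /\ K #!= [set: nat -> bool]) ->
  (C #= K \/ ~` C #= K) ->
  bss_reducible S C ->
  S #<= K \/ ~` S #<= K.
Proof.
move=> Kinf _ CK; have [C0 C0K CC0] : exists2 C0 : set (seq R[i]), C0 #= K &
    C = C0 \/ C = ~` C0.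
  case: CK => CK; first by exists C; last left.
  by exists (~` C); last by right; rewrite setCK.
by apply: bss_reducible_card_le Kinf C0K CC0.
Qed.
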